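(* Let $A$ and $B$ be vector spaces over a field of characteristic $0$, let $\mu:A\times A\to A$, $\nu:B\times B\to B$, $\vartriangleright:A\times B\to B$, $\vartriangleleft:B\times A\to B$, $\rightharpoonup:B\times A\to A$, $\leftharpoonup:A\times B\to A$, $\theta:A\times A\to B$ be bilinear maps and $D:A\to B$ a linear map. Write $a\cdot_A b=\mu(a,b)$, $x\cdot_B y=\nu(x,y)$, and let $\Omega\in\mathscr Q_1$ be $$\Omega((a,x),(b,y))=(a\cdot_A b+a\leftharpoonup y+x\rightharpoonup b,\ x\cdot_B y+a\vartriangleright y+x\vartriangleleft b+\theta(a,b)).$$ Then $(A_\mu,B_\nu,\vartriangleright,\vartriangleleft,\rightharpoonup,\leftharpoonup,\theta)$ is a quasi-twilled associative algebra and $D:A\to B$ is a strong deformation map in it if and only if the element $\alpha=(\Omega[1],D)\in(\mathscr Q[1]\oplus\mathfrak a)_0$ is a Maurer-Cartan element of the $L_\infty$-algebra $(\mathscr Q[1]\oplus\mathfrak a,\{\widetilde l_k\}_{k=1}^\infty)$ described in the context.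
   Context: The tuple $(A_\mu,B_\nu,\vartriangleright,\vartriangleleft,\rightharpoonup,\leftharpoonup,\theta)$ is a quasi-twilled associative algebra if the multiplication $\Omega$ on $A\oplus B$ is associative (i.e. $A\oplus B$ is an associative algebra having $B$ as a subalgebra, with these components). A strong deformation map in it is a linear map $D:A\to B$ with $D(a\cdot_A b+a\leftharpoonup D(b)+D(a)\rightharpoonup b)=D(a)\cdot_B D(b)+a\vartriangleright D(b)+D(a)\vartriangleleft b+\theta(a,b)$ for all $a,b\in A$. Let $\mathfrak g=\bigoplus_{n\ge0}\mathfrak g_n$, $\mathfrak g_n=\mathrm{Hom}((A\oplus B)^{\otimes n+1},A\oplus B)$, with the Gerstenhaber bracket: for $f$ with $m$ inputs and $g$ with $n$ inputs, $[f,g]=f\diamond g-(-1)^{(m-1)(n-1)}g\diamond f$, where $(f\diamond g)(v_1,\ldots,v_{m+n-1})=\sum_{i=1}^m(-1)^{(i-1)(n-1)}f(v_1,\ldots,v_{i-1},g(v_i,\ldots,v_{i+n-1}),v_{i+n},\ldots,v_{m+n-1})$. Let $\mathfrak a=\bigoplus_{n\ge0}\mathfrak a_n$, $\mathfrak a_n=\mathrm{Hom}(A^{\otimes n+1},B)\subset\mathfrak g_n$ (extension by zero), and $P:\mathfrak g\to\mathfrak a$ the projection: $P(F)$ is the $B$-component of $F|_{A^{\otimes n+1}}$ for $F\in\mathfrak g_n$. Let $\mathcal A^{k,l}$ be the direct sum of all $(k+l)$-fold tensor products with $k$ factors $A$ and $l$ factors $B$. For $k,l\ge-1$, $k+l=n$,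 $C^{k|l}\subset\mathfrak g_n$ is the space of $f$ with $f(\mathcal A^{k+1,l})\subset A$, $f(\mathcal A^{k,l+1})\subset B$, $f=0$ on other components. Put $\mathscr Q_n=C^{n+1|-1}\oplus C^{n|0}\oplus\cdots\oplus C^{0|n}$; $\mathscr Q=\bigoplus_{n\ge0}\mathscr Q_n$ is a graded Lie subalgebra of $\mathfrak g$. Write $(\mathscr Q[1])_n=\mathscr Q_{n+1}$, $F[1]$ for $F\in\mathscr Q$ viewed in $\mathscr Q[1]$. The $L_\infty$-structure on $\mathscr Q[1]\oplus\mathfrak a$ (degree $1$ graded symmetric operations satisfying the $L_\infty$ identities) has operations $\widetilde l_1(F[1],f)=P(F)$, $\widetilde l_2(F[1],G[1])=(-1)^{|F|}[F,G][1]$ ($|F|$ the degree of $F$ in $\mathscr Q$), $\widetilde l_k(F[1],f_1,\ldots,f_{k-1})=P[\cdots[[F,f_1],f_2],\ldots,f_{k-1}]$ for $k\ge2$, with $F,G\in\mathscr Q$, $f,f_i\in\mathfrak a$ homogeneous; up to permutation of entries all other components vanish. A Maurer-Cartan element is a degree $0$ element $\alpha$ with $\sum_{k\ge1}\frac1{k!}\widetilde l_k(\alpha,\ldots,\alpha)=0$ (a finite sum here). *)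

(* Defs.v *)
From mathcomp Require Import all_boot all_order all_algebra.
From mathcomp Require Import boolp classical_sets functions.

Set Implicit Arguments.
Unset Strict Implicit.
Unset Printing Implicit Defensive.

Import GRing.Theory.
Local Open Scope ring_scope.

(** * Quasi-twilled associative algebras and strong deformation maps *)

Section QuasiTwilled.
Variables (K : fieldType) (A B : lmodType K).
(* [tr a x], [tl x a], [hr x a] and [hl a x] stand respectively for
   a |> x and x <| a in B, and for x harpoon-right a and a harpoon-left x
   in A. *)
Variables (mu : A -> A -> A) (nu : B -> B -> B).
Variables (tr : A -> B -> B) (tl : B -> A -> B).
Variables (hr : B -> A -> A) (hl : A -> B -> A) (theta : A -> A -> B).

Definition Omega (u v : A * B) : A * B :=
  let: (a, x) := u in let: (b, y) := v in
  (mu a b + hl a y + hr x b, nu x y + tr a y + tl x b + theta a b).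

Definition quasi_twilled_associative : Prop := associative Omega.

Definition strong_deformation_map (D : A -> B) : Prop :=
  forall a b : A,
    D (mu a b + hl a (D b) + hr (D a) b) =
    nu (D a) (D b) + tr a (D b) + tl (D a) b + theta a b.

End QuasiTwilled.

(** * Cochains

  A cochain [U^(n+1) -> W] is encoded as a function on sequences, vanishing on
  the sequences whose size is not [n.+1]; a function [seq U -> W] is then a
  family of cochains, one for each number of arguments. This makes sums of
  cochains of different arities available in a single type. *)

Section Cochains.
Variables (K : fieldType) (U W : lmodType K).

Definition multilinear_cochain (n : nat) (f : seq U -> W) : Prop :=
  (forall s, size s != n.+1 -> f s = 0) /\
  (forall s1 s2, (size s1 + size s2)%N = n ->
     linear (fun u => f (s1 ++ u :: s2))).

Definition cochain1 (g : U -> W) (s : seq U) : W :=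
  if s is [:: u] then g u else 0.

Definition cochain2 (g : U -> U -> W) (s : seq U) : W :=
  if s is [:: u; v] then g u v else 0.

End Cochains.

(** * The Gerstenhaber bracket *)

Section Gerstenhaber.
Variables (K : fieldType) (V : lmodType K).
Implicit Types (f g : seq V -> V) (p q : nat).

(* [f] has p+1 inputs and [g] has q+1 inputs; [s] is meant to have size p+q+1.
   The index [i] starts from 0. *)
Definition gdiamond p q f g : seq V -> V := fun s =>
  \sum_(i < p.+1) (-1) ^+ (i * q) *:
     f (take i s ++ g (take q.+1 (drop i s)) :: drop (i + q.+1) s).

Definition hom_gbracket p q f g : seq V -> V :=
  gdiamond p q f g - (-1) ^+ (p * q) *: gdiamond q p g f.

(* Biadditive extension: the component of degree n of the bracket is the sum
   over p + q = n of the brackets of the components of degrees p and q. *)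
Definition gbracket f g : seq V -> V := fun s =>
  \sum_(p < size s) hom_gbracket p (size s - p.+1) f g s.

End Gerstenhaber.

(** * The L-infinity structure on Q[1] + a *)

Section Linfty.
Variables (K : fieldType) (A B : lmodType K).
Local Notation V := (A * B)%type.
Local Notation cochV := (seq V -> V).
Local Notation cochAB := (seq A -> B).

Definition inV (w : A + B) : V :=
  match w with inl a => (a, 0) | inr x => (0, x) end.
Definition isA (w : A + B) : bool := if w is inl _ then true else false.
Definition isB (w : A + B) : bool := ~~ isA w.

(* [w : seq (A + B)] lists the factors of a pure tensor in one of the summands
   of A^{k,l}, with k = count isA w and l = count isB w. *)
Definition bidegree (k l : int) (f : cochV) : Prop :=
  forall w : seq (A + B),
    let cA := (count isA w)%:Z in
    let cB := (count isB w)%:Z in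
    if (cA == k + 1) && (cB == l) then (f (map inV w)).2 = 0
    else if (cA == k) && (cB == l + 1) then (f (map inV w)).1 = 0
    else f (map inV w) = 0.

Definition in_C (n : nat) (k l : int) (f : cochV) : Prop :=
  multilinear_cochain n f /\ bidegree k l f.

Definition in_Q (d : int) (F : cochV) : Prop :=
  match d with
  | Posz n => exists Fs : nat -> cochV,
      (forall j, (j < n.+2)%N -> in_C n (n.+1%:Z - j%:Z) (j%:Z - 1) (Fs j)) /\
      F = \sum_(j < n.+2) Fs j
  | Negz _ => F = 0
  end.

Definition in_a (d : int) (f : cochAB) : Prop :=
  match d with
  | Posz n => multilinear_cochain n f
  | Negz _ => f = 0
  end.

Definition ext0 (f : cochAB) : cochV := fun s => (0, f (unzip1 s)).

Definition projP (F : cochV) : cochAB := fun s => (F [seq (a, 0) | a <- s]).2.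

(* [(F, f)] stands for the pair of F[1] and f. *)
Definition Linf : lmodType K := (cochV * cochAB)%type.

Definition in_Linf (d : int) (x : Linf) : Prop :=
  in_Q (d + 1) x.1 /\ in_a d x.2.

(* The operations, as multilinear maps on k-tuples of homogeneous elements, each
   given with its degree in Q[1] + a. The value is the sum of the values on the
   tuples of components: in the Q[1]-part, only the pair of Q[1]-components of
   two arguments contributes; in the a-part, the tuples with exactly one
   component, say the i-th, in Q[1] contribute, the sign being the Koszul sign
   for moving that component to the front. *)
Definition lop (xs : seq (int * Linf)) : Linf :=
  (if xs is [:: (d, (F, _)); (_, (G, _))]
   then (-1) ^ (d + 1) *: gbracket F G else 0,
   \sum_(i < size xs)
      let: (d, (F, _)) := xs`_i in
      let: fs := [seq ext0 y.2.2 | y <- take i xs ++ drop i.+1 xs] in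
      (-1) ^ (d * \sum_(y <- take i xs) y.1) *: projP (foldl (@gbracket K V) F fs)).

Definition maurer_cartan (x : Linf) : Prop :=
  in_Linf 0 x /\
  exists2 N : nat,
    forall k, (N < k)%N -> lop (nseq k (0, x)) = 0 &
    \sum_(1 <= k < N.+1) (k`!%:R)^-1 *: lop (nseq k (0, x)) = 0.

End Linfty.

(* Main.v *)
Require Import Defs.
From mathcomp Require Import all_boot all_order all_algebra.
From mathcomp Require Import boolp classical_sets functions.
Import GRing.Theory.
Local Open Scope ring_scope.

(** Why the theorem is true.

  Write [g] for the linear endomorphism [(a, x) |-> (0, D a)] of [A * B], which
  is the extension by zero of [D]. The bracket of a bilinear map [F] with [g] is
  again bilinear,
    [[F, g] (u, v) = F (g u) v + F u (g v) - g (F u v)]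
  ([bracket21], [gbracket21]), so every iterated bracket of [Omega] with [g] in the
  Maurer-Cartan sum is a 2-cochain. Since [g] squares to zero, the second bracket
  is [2 (F (g u) (g v) - g (F (g u) v) - g (F u (g v)))] and the third one is
  [- 6 g (F (g u) (g v))] ([bracket21_2], [bracket21_3]). For [F = Omega] the third
  one vanishes because [Omega] maps [B * B] to [B], on which [g] is zero. Hence
  only the operations with one, two or three entries contribute, and the
  Maurer-Cartan sum has the two components ([mc_sumE])
    [- 1/2 [Omega, Omega]]  and
    [(a, b) |-> (Omega (a, D a) (b, D b)).2 - D (Omega (a, D a) (b, D b)).1].
  As [[Omega, Omega] (u, v, w)] is twice the associator of [Omega]
  ([gbracket22]), the first component vanishes exactly when [Omega] is
  associative, the characteristic being 0. The second one vanishes exactly when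
  the graph of [D] is closed under [Omega], which is, once [Omega] is written out,
  the strong deformation equation. Finally the pair always lies in degree 0, the
  components of [Omega] being sorted by bidegree ([Omega_in_Q]). *)

(** * Linear and bilinear maps as cochains *)

Local Notation bilin F := (bilinear_for *:%R *:%R F).

Lemma bilin_map (K : fieldType) (U U' W : lmodType K)
  (F : {bilinear U -> U' -> W}) : bilin F.
Proof. by split=> [v|u] a x y; rewrite ?linearPl ?linearPr. Qed.

Lemma bilin0 (K : fieldType) (U U' W : lmodType K) :
  bilin (fun (_ : U) (_ : U') => 0 : W).
Proof. by split=> [v|u] a x y /=; rewrite scaler0 addr0. Qed.

Lemma linear_fun0 (K : fieldType) (U W : lmodType K) (f : U -> W) :
  linear f -> f 0 = 0.
Proof.
by move=> lf; have := lf (-1) 0 0; rewrite /= scaler0 addr0 scaleN1r addNr.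
Qed.

Lemma linear_funD (K : fieldType) (U W : lmodType K) (f : U -> W) u v :
  linear f -> f (u + v) = f u + f v.
Proof. by move=> lf; have := lf 1 u v; rewrite /= !scale1r. Qed.

Lemma linear_funN (K : fieldType) (U W : lmodType K) (f : U -> W) u :
  linear f -> f (- u) = - f u.
Proof.
move=> lf; have := lf (-1) u 0.
by rewrite /= (linear_fun0 _ _ _ _ lf) !addr0 !scaleN1r.
Qed.

Lemma multilinear_cochain_cat0 (K : fieldType) (U W : lmodType K) n
    (f : seq U -> W) s1 s2 :
  multilinear_cochain n f -> f (s1 ++ 0 :: s2) = 0.
Proof.
move=> [fs fl]; have [e|ne] := eqVneq (size s1 + size s2)%N n.
  exact: linear_fun0 (fl _ _ e).
by apply: fs; rewrite size_cat /= addnS.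
Qed.

Lemma multilinear_cochain1 (K : fieldType) (U W : lmodType K) (g : U -> W) :
  linear g -> multilinear_cochain 0 (cochain1 g).
Proof. by move=> lg; split; [case=> [|u []] | case=> [|u s1] []]. Qed.

Lemma multilinear_cochain2 (K : fieldType) (U W : lmodType K)
    (F : U -> U -> W) :
  bilin F -> multilinear_cochain 1 (cochain2 F).
Proof.
move=> [Fl Fr]; split; first by case=> [|u [|v []]].
by move=> [|u [|? ?]] [|v [|? ?]] //=.
Qed.

(** * Gerstenhaber brackets of cochains with one and two arguments *)

Section Brackets.
Variables (K : fieldType) (V : lmodType K).
Implicit Types (s : seq V) (F : V -> V -> V).

(** At the size of its intended arguments, the circle product of two homogeneous
  cochains vanishes in all degrees other than theirs. *)
Lemma gdiamond_eq0 a b p q f g s :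
  multilinear_cochain a f -> multilinear_cochain b g ->
  size s = (p + q).+1 -> (p, q) != (a, b) -> gdiamond p q f g s = 0.
Proof.
move=> mf mg ss npq; apply: big1 => i _.
have ip : (i <= p)%N by rewrite -ltnS.
have [eq|nq] := eqVneq q b; last first.
  (* The inner value is 0, and f vanishes when one of its arguments does. *)
  rewrite (mg.1 (take _ _)).
    by rewrite (multilinear_cochain_cat0 _ _ _ _ _ _ _ mf) scaler0.
  by rewrite size_takel ?eqSS // size_drop ss ltn_subRL ltnS leq_add2r.
rewrite mf.1 ?scaler0 //.
have -> : size (take i s ++ g (take q.+1 (drop i s)) :: drop (i + q.+1) s)
    = p.+1.
  rewrite size_cat /= size_takel ?ss; last first.
    by rewrite ltnW // ltnS (leq_trans ip) ?leq_addr.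
  by rewrite size_drop ss [(i + q.+1)%N]addnS subSS subnDr addnS subnKC.
by apply: contraNN npq; rewrite eqSS eq => /eqP->.
Qed.

(** On homogeneous cochains, the biadditive bracket reduces to a single term. *)
Lemma gbracket_hom a b f g s :
  multilinear_cochain a f -> multilinear_cochain b g ->
  gbracket f g s = if size s == (a + b).+1 then hom_gbracket a b f g s else 0.
Proof.
move=> mf mg.
have hom0 p : (p < size s)%N -> (p, size s - p.+1)%N != (a, b) ->
    hom_gbracket p (size s - p.+1) f g s = 0.
  move=> ps npq; have ss : size s = (p + (size s - p.+1)).+1.
    by rewrite -addSn subnKC.
  rewrite /hom_gbracket !fctE (gdiamond_eq0 a b) //.
  rewrite (gdiamond_eq0 b a) ?scaler0 ?subr0 // 1?addnC //.
  by apply: contraNneq npq => -[-> ->].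
rewrite /gbracket; case: eqP => [es|ns].
  have ias : (a < size s)%N by rewrite es ltnS leq_addr.
  rewrite (bigD1 (Ordinal ias)) //= big1 ?addr0 => [|i nia].
    by rewrite {1}es subSS addKn.
  by apply: hom0 => //; apply: contraNneq nia => -[ia _]; apply/eqP/val_inj.
apply: big1 => i _; apply: hom0 => //; apply/eqP => -[ia ib]; apply: ns.
by rewrite -ia -ib -addSn subnKC.
Qed.

(** The bracket of a bilinear map [F] with a linear map [g], as a bilinear map;
  up to sign it is the failure of [g] to be a derivation of [F]. *)
Definition bracket21 (g : V -> V) (F : V -> V -> V) (u v : V) : V :=
  F (g u) v + F u (g v) - g (F u v).

Lemma bracket21_bilin (g : V -> V) F :
  linear g -> bilin F -> bilin (bracket21 g F).
Proof.
move=> lg [Fl Fr].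
split=> [w|w] a x y; rewrite /= /bracket21 ?(lg, Fl, Fr) /= ?(lg, Fl, Fr) /=.
  by rewrite addrACA -scalerDr opprD addrACA -scalerN -scalerDr.
by rewrite addrACA -scalerDr opprD addrACA -scalerN -scalerDr.
Qed.

Lemma gbracket21 (F : V -> V -> V) (g : V -> V) : bilin F -> linear g ->
  gbracket (cochain2 F) (cochain1 g) = cochain2 (bracket21 g F).
Proof.
move=> bF lg; apply/funext => s.
rewrite (gbracket_hom 1 0);
  [|exact: multilinear_cochain2|exact: multilinear_cochain1].
case: s => [|u [|v []]] //=.
rewrite /hom_gbracket !fctE /gdiamond !big_ord_recr !big_ord0 /=.
by rewrite !muln0 !mul0n !add0r !expr0 !scale1r.
Qed.

Lemma gbracket22 (F : V -> V -> V) u v w : bilin F ->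
  gbracket (cochain2 F) (cochain2 F) [:: u; v; w] =
    (F (F u v) w - F u (F v w)) *+ 2.
Proof.
move=> bF; rewrite (gbracket_hom 1 1); [|exact: multilinear_cochain2..].
rewrite /= /hom_gbracket !fctE /gdiamond !big_ord_recr !big_ord0 /=.
by rewrite !add0r mul0n !muln1 expr0 expr1 !scale1r !scaleN1r opprK mulr2n.
Qed.

Lemma gbracket22_eq0 (F : V -> V -> V) : [pchar K] =i pred0 -> bilin F ->
  gbracket (cochain2 F) (cochain2 F) = 0 <-> associative F.
Proof.
move=> charK0 bF; split=> [FF0 u v w|assF].
  have /eqP : (F (F u v) w - F u (F v w)) *+ 2 = 0.
    by rewrite -gbracket22 // FF0.
  rewrite -scaler_nat scaler_eq0 ((pcharf0P _).1 charK0) /= subr_eq0.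
  by move/eqP.
apply/funext => s.
have [ss|ns] := eqVneq (size s) 3; last first.
  by rewrite (gbracket_hom 1 1) ?(negPf ns) //; exact: multilinear_cochain2.
case: s ss => [|u [|v [|w []]]] //= _.
by rewrite gbracket22 // assF subrr mul0rn.
Qed.

Lemma iter_bracket21_bilin (g : V -> V) F n :
  linear g -> bilin F -> bilin (iter n (bracket21 g) F).
Proof. by move=> lg bF; elim: n => [|n IHn] //; exact: bracket21_bilin lg IHn. Qed.

Lemma foldl_gbracket21 (F : V -> V -> V) (g : V -> V) n :
  bilin F -> linear g ->
  foldl (@gbracket K V) (cochain2 F) (nseq n (cochain1 g)) =
  cochain2 (iter n (bracket21 g) F).
Proof.
move=> + lg; elim: n F => //= n IHn F bF.
by rewrite gbracket21 // IHn -?iterSr //; exact: bracket21_bilin.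
Qed.

Section SquareZero.
Variables (g : V -> V) (F : V -> V -> V).
Hypotheses (lg : linear g) (gg0 : forall u, g (g u) = 0) (bF : bilin F).

Lemma bracket21_2 u v : iter 2 (bracket21 g) F u v =
  (F (g u) (g v) - g (F (g u) v) - g (F u (g v))) *+ 2.
Proof.
have F0 w : F 0 w = 0 by apply: (linear_fun0 _ _ _ (F^~ w)); case: bF.
have Fr0 w : F w 0 = 0 by apply: linear_fun0; case: bF.
have gD x y : g (x + y) = g x + g y by apply: linear_funD.
have gN x : g (- x) = - g x by apply: linear_funN.
rewrite /= /bracket21 !gD !gN !gg0 F0 Fr0 oppr0 !addr0 add0r.
move: (F (g u) (g v)) (g (F (g u) v)) (g (F u (g v))) => P Q R.
by rewrite addrACA -[P - Q - R]addrA -(opprD Q R) mulr2n [RHS]addrACA addrA.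
Qed.

Lemma bracket21_3 u v :
  iter 3 (bracket21 g) F u v = - g (F (g u) (g v)) *+ 6.
Proof.
have F0 w : F 0 w = 0 by apply: (linear_fun0 _ _ _ (F^~ w)); case: bF.
have Fr0 w : F w 0 = 0 by apply: linear_fun0; case: bF.
have gD x y : g (x + y) = g x + g y by apply: linear_funD.
have gN x : g (- x) = - g x by apply: linear_funN.
have g0 : g 0 = 0 by apply: linear_fun0.
rewrite iterS {1}/bracket21 !bracket21_2 !gg0 !F0 !Fr0 !g0.
rewrite !subr0 !sub0r mulr2n [in X in _ - X]mulr2n !gD !gN !gg0 !subr0 -!mulr2n.
by rewrite -!mulNrn -mulrnA -mulrnDr.
Qed.

End SquareZero.
End Brackets.
Arguments bracket21 {K V} g F u v.

(** * The Maurer-Cartan equation *)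

Lemma take_drop_nseq (T : Type) (x : T) i k :
  (i < k)%N -> take i (nseq k x) ++ drop i.+1 (nseq k x) = nseq k.-1 x.
Proof.
move=> ik; have ik' : (i <= k.-1)%N by rewrite -ltnS prednK // (leq_trans _ ik).
rewrite take_nseq ?(ltnW ik) // drop_nseq -nseqD.
by rewrite subnS -subn1 subnAC subn1 subnKC.
Qed.

(** On [k] copies of an element of degree 0 every Koszul sign is 1, so the [k]
  positions that the component in [Q[1]] can take all contribute equally. *)
Lemma lop_nseq (K : fieldType) (A B : lmodType K) k (F : seq (A * B) -> A * B)
    (f : seq A -> B) :
  lop (nseq k (0, (F, f) : Linf A B)) =
  (if k == 2 then - gbracket F F else 0,
   k%:R *: projP (foldl (@gbracket K _) F (nseq k.-1 (ext0 f)))).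
Proof.
rewrite /lop size_nseq; congr (_, _).
  by case: k => [|[|[|k]]] //=; rewrite expr1z scaleN1r.
under eq_bigr => i _.
  rewrite nth_nseq ltn_ord mul0r expr0z scale1r take_drop_nseq // map_nseq /=.
  over.
by rewrite sumr_const card_ord scaler_nat.
Qed.

Lemma big_nat_trim (W : nmodType) (t : nat -> W) m n1 n2 :
  (forall k, (n1 <= k)%N -> t k = 0) -> (forall k, (n2 <= k)%N -> t k = 0) ->
  \sum_(m <= k < n1) t k = \sum_(m <= k < n2) t k.
Proof.
wlog le12 : n1 n2 / (n1 <= n2)%N.
  move=> wl t1 t2.
  by case/orP: (leq_total n1 n2) => ?; [|apply: esym]; apply: wl.
move=> t1 _; rewrite (big_nat_widen _ _ _ _ _ le12) big_mkcond.
apply: eq_bigr => k _.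
by case: ltnP => // /t1.
Qed.

Lemma invf_fact (K : fieldType) k : [pchar K] =i pred0 ->
  (k.+1`!)%:R^-1 * k.+1%:R = (k`!)%:R^-1 :> K.
Proof.
move=> charK0; rewrite factS natrM invfM mulrAC mulVf ?mul1r //.
by rewrite ((pcharf0P _).1 charK0).
Qed.

Lemma projP_cochain2 (K : fieldType) (A B : lmodType K)
    (F : A * B -> A * B -> A * B) :
  projP (cochain2 F) = cochain2 (fun a b => (F (a, 0) (b, 0)).2).
Proof. by apply/funext => -[|a [|b []]]. Qed.

Lemma cochain2_eq0 (K : fieldType) (U W : lmodType K) (F : U -> U -> W) :
  cochain2 F = 0 <-> forall u v, F u v = 0.
Proof.
split=> [F0 u v|F0]; first exact: (congr1 (@^~ [:: u; v]) F0).
by apply/funext => -[|u [|v []]] //=; rewrite F0.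
Qed.

(** The extension of [D : A -> B] by zero to an endomorphism of [A * B]. *)
Definition vert {K : fieldType} {A B : lmodType K} (D : A -> B) (u : A * B) :
  A * B := (0, D u.1).

Lemma vert_linear (K : fieldType) (A B : lmodType K) (D : A -> B) :
  linear D -> linear (vert D).
Proof.
by move=> lD a u v; rewrite /vert /= lD; congr (_, _); rewrite /= scaler0 addr0.
Qed.

Lemma vertK0 (K : fieldType) (A B : lmodType K) (D : A -> B) u :
  linear D -> vert D (vert D u) = 0.
Proof. by move=> lD; rewrite /vert /= (linear_fun0 _ _ _ _ lD). Qed.

Lemma ext0_cochain1 (K : fieldType) (A B : lmodType K) (D : A -> B) :
  ext0 (cochain1 D) = cochain1 (vert D).
Proof. by apply/funext => -[|u []]. Qed.

Lemma Omega_bilin (K : fieldType) (A B : lmodType K)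
    (mu : A -> A -> A) (nu : B -> B -> B) (tr : A -> B -> B) (tl : B -> A -> B)
    (hr : B -> A -> A) (hl : A -> B -> A) (theta : A -> A -> B) :
  bilin mu -> bilin nu -> bilin tr -> bilin tl -> bilin hr -> bilin hl ->
  bilin theta -> bilin (Omega mu nu tr tl hr hl theta).
Proof.
move=> [mul mur] [nul nur] [trl trr] [tll tlr] [hrl hrr] [hll hlr] [thl thr].
have sum3 (W : zmodType) (x y z x' y' z' : W) :
    x + x' + (y + y') + (z + z') = x + y + z + (x' + y' + z').
  by rewrite [RHS]addrACA; congr (_ + _); apply: addrACA.
have sum4 (W : zmodType) (x y z t x' y' z' t' : W) :
    x + x' + (y + y') + (z + z') + (t + t') =
    x + y + z + t + (x' + y' + z' + t').
  by rewrite [RHS]addrACA; congr (_ + _); apply: sum3.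
split=> -[c z] a [a1 x1] [a2 x2] /=.
  rewrite mul nul trl tll hrl hll thl.
  by congr (_, _); rewrite /= !scalerDr (sum4, sum3).
rewrite mur nur trr tlr hrr hlr thr.
by congr (_, _); rewrite /= !scalerDr (sum4, sum3).
Qed.

(** Maurer-Cartan elements [(W, D)] are studied for an arbitrary bilinear [W] on
  [A * B] for which [B * B] is mapped to [B]. *)
Section MaurerCartanElements.
Variables (K : fieldType) (A B : lmodType K) (charK0 : [pchar K] =i pred0).
Variables (W : A * B -> A * B -> A * B) (D : A -> B).
Hypotheses (bW : bilin W) (lD : linear D).
Hypothesis WBB : forall x y, (W (0, x) (0, y)).1 = 0.
Local Notation g := (vert D).
Local Notation alpha := ((cochain2 W, cochain1 D) : Linf A B).
Local Notation mc_term k := ((k`!%:R)^-1 *: lop (nseq k (0, alpha))).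
Local Notation d := (bracket21 g).

(** The [k.+1] equal contributions turn the coefficient [1 / k.+1`!] into
  [1 / k`!]. *)
Lemma mc_termS k :
  mc_term k.+1 =
  ((if k == 1%N then - 2%:R^-1 *: gbracket (cochain2 W) (cochain2 W) else 0),
   (k`!%:R)^-1 *: cochain2 (fun a b => (iter k d W (a, 0) (b, 0)).2)).
Proof.
rewrite lop_nseq ext0_cochain1 foldl_gbracket21 //; last exact: vert_linear.
rewrite projP_cochain2; congr (_, _); rewrite /=.
  by case: k => [|[|k]] /=; rewrite ?scaler0 // scalerN scaleNr.
by rewrite scalerA invf_fact.
Qed.

Lemma iter_bracket21_vert k u v : (3 <= k)%N -> iter k d W u v = 0.
Proof.
have lg := vert_linear _ _ _ D lD; move=> k3.
have g0 : g 0 = 0 by apply: linear_fun0.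
have d3 u' v' : iter 3 d W u' v' = 0.
  rewrite (bracket21_3 _ _ _ _ lg (fun w => vertK0 _ _ _ _ w lD) bW).
  (* The image of g lies in B, W maps B * B to B, and g vanishes on B. *)
  have -> : g (W (g u') (g v')) = 0.
    by congr (_, _); rewrite WBB; apply: linear_fun0.
  by rewrite oppr0 mul0rn.
rewrite -(subnK k3) iterD.
elim: (k - 3)%N u v => [|n IHn] u v; first exact: d3.
by rewrite iterS /bracket21 !IHn g0 subr0 addr0.
Qed.

Lemma mc_term_eq0 k : (3 < k)%N -> mc_term k = 0.
Proof.
case: k => // k k3; rewrite mc_termS.
have -> : cochain2 (fun a b => (iter k d W (a, 0) (b, 0)).2) = 0.
  by apply/cochain2_eq0 => a b; rewrite iter_bracket21_vert.
by rewrite scaler0; case: k k3 => [|[|k]].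
Qed.

(** The component in [a] is the [B]-component of [exp (- g) \o W] evaluated at
  [exp g (a, 0)] and [exp g (b, 0)], where [exp g (a, 0) = (a, D a)]; it measures
  the failure of the graph of [D] to be closed under [W]. *)
Lemma mc_sumE :
  \sum_(1 <= k < 4) mc_term k =
  (- 2%:R^-1 *: gbracket (cochain2 W) (cochain2 W),
   cochain2 (fun a b =>
     (W (a, D a) (b, D b)).2 - D (W (a, D a) (b, D b)).1)).
Proof.
have lg := vert_linear _ _ _ D lD.
rewrite big_ltn // big_ltn // big_nat1 !mc_termS.
(* Abstracting the double bracket keeps simplification from unfolding it. *)
have := bracket21_2 _ _ _ _ lg (fun w => vertK0 _ _ _ _ w lD) bW.
move: (iter 2 d W) => d2W d2E.
apply: injective_projections => /=; first by rewrite add0r addr0.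
apply/funext => -[|a [|b [|c s]]]; rewrite ?fctE /= ?scaler0 ?addr0 //.
have WE : W (a, D a) (b, D b) = W (a, 0) (b, 0) + W (g (a, 0)) (b, 0) +
    (W (a, 0) (g (b, 0)) + W (g (a, 0)) (g (b, 0))).
  have split u : (u, D u) = (u, 0) + g (u, 0).
    by apply: injective_projections; rewrite /= ?addr0 ?add0r.
  rewrite !split; case: bW => Wl Wr.
  rewrite (linear_funD _ _ _ (W _) _ _ (Wr _)).
  by rewrite !(linear_funD _ _ _ (W^~ _) _ _ (Wl _)).
rewrite d2E WE /= WBB addr0 !(linear_funD _ _ _ _ _ _ lD).
rewrite -mulr2n -scaler_nat scalerA mulVf ?((pcharf0P _).1 charK0) //.
rewrite !fact0 !invr1 !scale1r.
move: (W _ _).2 (W _ _).2 (W _ _).2 (W _ _).2 (D _) (D _) (D _).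
move=> t r q p s3 s2 s1.
by rewrite -[t - s2 - s3]addrA -(opprD s2) addrACA -(opprD s1) !addrA.
Qed.

Lemma maurer_cartan_pair : in_Linf 0 alpha ->
  maurer_cartan alpha <->
  associative W /\
  forall a b, D (W (a, D a) (b, D b)).1 = (W (a, D a) (b, D b)).2.
Proof.
move=> Lx; have sum0 : \sum_(1 <= k < 4) mc_term k = 0 <->
    associative W /\
    forall a b, D (W (a, D a) (b, D b)).1 = (W (a, D a) (b, D b)).2.
  rewrite mc_sumE; split=> [E|[aW DW]].
    have [E1 E2] : (- 2%:R^-1 *: gbracket (cochain2 W) (cochain2 W) = 0) /\
      cochain2 (fun a b =>
        (W (a, D a) (b, D b)).2 - D (W (a, D a) (b, D b)).1) = 0.
      by move: (congr1 fst E) (congr1 snd E).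
    split; last first.
      by move=> a b; apply/esym/subr0_eq; apply: (cochain2_eq0 _ _ _ _).1 E2 a b.
    apply/(gbracket22_eq0 _ _ W charK0 bW).
    rewrite -[LHS]scale1r -(mulfV (_ : - 2%:R != 0 :> K)); last first.
      by rewrite oppr_eq0 ((pcharf0P _).1 charK0).
    by rewrite -scalerA invrN E1 scaler0.
  rewrite ((gbracket22_eq0 _ _ W charK0 bW).2 aW) scaler0; congr (_, _).
  by apply/cochain2_eq0 => a b; rewrite DW subrr.
rewrite -sum0; split=> [[_ [N tN sumN]]|sum3].
  apply: etrans sumN; apply: (big_nat_trim _ (fun k => mc_term k)) => k.
    exact: mc_term_eq0.
  by move=> Nk; rewrite tN ?scaler0.
split=> //; exists 3%N => // k k3; have /eqP := mc_term_eq0 k k3.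
rewrite scaler_eq0 invr_eq0 ((pcharf0P _).1 charK0) eqn0Ngt fact_gt0 /=.
by move/eqP.
Qed.
End MaurerCartanElements.

(** * Bidegrees of the multiplication *)

Lemma Omega_in_Q (K : fieldType) (A B : lmodType K)
    (mu : {bilinear A -> A -> A}) (nu : {bilinear B -> B -> B})
    (tr : {bilinear A -> B -> B}) (tl : {bilinear B -> A -> B})
    (hr : {bilinear B -> A -> A}) (hl : {bilinear A -> B -> A})
    (theta : {bilinear A -> A -> B}) :
  in_Q 1 (cochain2 (Omega mu nu tr tl hr hl theta)).
Proof.
(* O1, O2 and O3 are the parts of bidegree 2|-1, 1|0 and 0|1. *)
pose O1 := Omega (fun _ _ => 0) (fun _ _ => 0) (fun _ _ => 0) (fun _ _ => 0)
  (fun _ _ => 0) (fun _ _ => 0) theta.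
pose O2 := Omega mu (fun _ _ => 0) tr tl (fun _ _ => 0) (fun _ _ => 0)
  (fun _ _ => 0).
pose O3 := Omega (fun _ _ => 0) nu (fun _ _ => 0) (fun _ _ => 0) hr hl
  (fun _ _ => 0).
exists (fun j => cochain2 (nth O3 [:: O1; O2] j)); split; last first.
  rewrite !big_ord_recr big_ord0 /= add0r.
  apply/funext => -[|[a x] [|[b y] []]]; rewrite ?fctE /= ?addr0 //.
  apply: injective_projections; rewrite /O1 /O2 /O3 /= !(addr0, add0r) ?addrA //.
  by rewrite [LHS]addrC -!addrA; congr (_ + _); rewrite addrC -addrA.
move=> j j3; split.
  apply: multilinear_cochain2.
  case: j j3 => [|[|[]]] // _; apply: Omega_bilin;
    (exact: bilin_map || exact: bilin0).
(* A word that is not of length 2 is killed by the cochain; the four words of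
   length 2 are checked one by one. *)
move=> w.
case: j j3 => [|[|[]]] // _; case: w => [|[a|x] [|[b|y] [|c w]]] /=;
  by do ?case: ifP; rewrite ?(linear0l, linear0r) ?addr0.
Qed.

Theorem theorem5p7 (K : fieldType) (charK0 : [pchar K] =i pred0)
    (A B : lmodType K)
    (mu : {bilinear A -> A -> A}) (nu : {bilinear B -> B -> B})
    (tr : {bilinear A -> B -> B}) (tl : {bilinear B -> A -> B})
    (hr : {bilinear B -> A -> A}) (hl : {bilinear A -> B -> A})
    (theta : {bilinear A -> A -> B}) (D : {linear A -> B}) :
  (quasi_twilled_associative mu nu tr tl hr hl theta /\
   strong_deformation_map mu nu tr tl hr hl theta D) <->
  maurer_cartan
    ((cochain2 (Omega mu nu tr tl hr hl theta), cochain1 D) : Linf A B).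
Proof.
have lD : linear D := linearP D.
apply: iff_sym; apply: (maurer_cartan_pair _ _ _ charK0 _ _ _ lD).
- by apply: Omega_bilin; exact: bilin_map.
- by move=> x y /=; rewrite !(linear0l, linear0r) !addr0.
- by split; [exact: Omega_in_Q | exact: multilinear_cochain1].
Qed.
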